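(* Let $\mathbf{L}:\mathbb{R}^N\to\mathrm{Sym}^n$ be a continuous function. Given $\mathcal{I}\subset[n]$, the normalized merged eigenspace map $\mathcal{V}_{\mathcal{I}}$ is continuous (i.e., both upper and lower hemicontinuous) at any $\mathbf{x}$ such that $\lambda_i(\mathbf{x})\neq\lambda_j(\mathbf{x})$ for all $i\in\mathcal{I}$ and $j\notin\mathcal{I}$.
   Context: $[n]=\{1,\dots,n\}$; $\mathrm{Sym}^n$ is the space of real symmetric $n\times n$ matrices. $\lambda_1(\mathbf{x})\le\dots\le\lambda_n(\mathbf{x})$ denote the eigenvalues of $\mathbf{L}(\mathbf{x})$ counted with multiplicity, in increasing order. $\mathbb{S}^n=\{\mathbf{v}\in\mathbb{R}^n\mid\|\mathbf{v}\|=1\}$. For $p\in[n]$, $\mathcal{V}_p(\mathbf{x})=\{\mathbf{v}\in\mathbb{S}^n\mid\mathbf{L}(\mathbf{x})\mathbf{v}=\lambda_p(\mathbf{x})\mathbf{v}\}$, and the normalized merged eigenspace is the set-valued map $$\mathcal{V}_{\mathcal{I}}(\mathbf{x})=\mathrm{span}\Big\{\bigcup_{p\in\mathcal{I}}\mathcal{V}_p(\mathbf{x})\Big\}\cap\mathbb{S}^n .$$ A set-valued map $\mathcal{U}$ from $\mathbb{R}^N$ to subsets of $\mathbb{R}^M$ is: upper hemicontinuous at $\mathbf{x}$ if for any neighborhood $\bar{\mathcal{U}}$ of $\mathcal{U}(\mathbf{x})$ there exists $\delta>0$ such that $\|\mathbf{x}-\mathbf{x}'\|<\delta$ implies $\mathcal{U}(\mathbf{x}')\subset\bar{\mathcal{U}}$;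 lower hemicontinuous at $\mathbf{x}$ if for each $\mathbf{u}\in\mathcal{U}(\mathbf{x})$ and any sequence $\{\mathbf{x}^k\}$ converging to $\mathbf{x}$ there exists a sequence $\{\mathbf{u}^k\}$ converging to $\mathbf{u}$ with $\mathbf{u}^k\in\mathcal{U}(\mathbf{x}^k)$; continuous at $\mathbf{x}$ if both. *)

(* Defs.v *)
From mathcomp Require Import all_boot all_order all_algebra.
From mathcomp Require Import polyrcf.
From mathcomp Require Import all_classical all_reals all_analysis.

Set Implicit Arguments.
Unset Strict Implicit.
Unset Printing Implicit Defensive.

Import Order.TTheory GRing.Theory Num.Theory.
Import numFieldNormedType.Exports.

Local Open Scope classical_set_scope.
Local Open Scope ring_scope.

(* Vectors of R^n are column vectors 'cV[R]_n.  The library norm `|v| on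
   matrices is the sup norm; enorm is the Euclidean one.  Both induce the
   library topology on 'cV[R]_n. *)
Definition enorm (R : realType) (n : nat) (v : 'cV[R]_n) : R :=
  Num.sqrt (\sum_(i < n) v i 0 ^+ 2).

Definition unit_sphere (R : realType) (n : nat) : set 'cV[R]_n :=
  [set v | enorm v = 1].

(* rootsR p lists the distinct real roots of p in increasing order; each one
   is repeated here according to its multiplicity in the characteristic
   polynomial. *)
Definition eigenvalues (R : realType) (n : nat) (A : 'M[R]_n) : seq R :=
  flatten [seq nseq (mup z (char_poly A)) z | z <- rootsR (char_poly A)].

(* The p-th smallest eigenvalue, p being counted from 0.  For symmetric A the
   sequence eigenvalues A has size n, so the default value 0 is never used. *)
Definition eigval (R : realType) (n : nat) (A : 'M[R]_n) (p : 'I_n) : R :=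
  nth 0 (eigenvalues A) p.

Definition unit_eigenvectors (R : realType) (n : nat) (A : 'M[R]_n)
    (p : 'I_n) : set 'cV[R]_n :=
  [set v | unit_sphere v /\ A *m v = eigval A p *: v].

(* Linear span of an arbitrary, possibly infinite, set of vectors; the span of
   set0 is {0}. *)
Definition set_span (R : realType) (n : nat) (S : set 'cV[R]_n) :
    set 'cV[R]_n :=
  [set v | exists2 X : seq 'cV[R]_n,
             (forall u, u \in X -> S u) & v \in <<X>>%VS].

Definition merged_eigenspace (R : realType) (N n : nat)
    (L : 'cV[R]_N -> 'M[R]_n) (I : {set 'I_n}) (x : 'cV[R]_N) :
    set 'cV[R]_n :=
  set_span (\bigcup_(p in [set` I]) unit_eigenvectors (L x) p)
    `&` @unit_sphere R n.

Definition upper_hemicontinuous_at (R : realType) (N M : nat)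
    (U : 'cV[R]_N -> set 'cV[R]_M) (x : 'cV[R]_N) : Prop :=
  forall V : set 'cV[R]_M, set_nbhs (U x) V ->
    exists2 delta : R, 0 < delta &
      forall x', enorm (x - x') < delta -> U x' `<=` V.

Definition lower_hemicontinuous_at (R : realType) (N M : nat)
    (U : 'cV[R]_N -> set 'cV[R]_M) (x : 'cV[R]_N) : Prop :=
  forall u, U x u ->
  forall xs : nat -> 'cV[R]_N, xs @ \oo --> x ->
    exists2 us : nat -> 'cV[R]_M,
      us @ \oo --> u & forall k, U (xs k) (us k).

Definition hemicontinuous_at (R : realType) (N M : nat)
    (U : 'cV[R]_N -> set 'cV[R]_M) (x : 'cV[R]_N) : Prop :=
  upper_hemicontinuous_at U x /\ lower_hemicontinuous_at U x.

(* Main.v *)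
Require Import Defs.
From mathcomp Require Import all_boot all_order all_algebra.
From mathcomp Require Import complex polyrcf.
From mathcomp Require Import fingroup perm ring lra.
From mathcomp Require Import all_classical all_reals all_analysis.

Import Order.TTheory GRing.Theory Num.Theory.
Import numFieldNormedType.Exports.

Local Open Scope classical_set_scope.
Local Open Scope ring_scope.
Set Implicit Arguments.
Unset Strict Implicit.
Unset Printing Implicit Defensive.

(** Let A = L x and B = L x' be symmetric with orthonormal eigenbases ordered by
    increasing eigenvalue ([symmetric_eigenbasis]).

    If u and w are unit eigenvectors of A and B for eigenvalues a and b, then
    (a - b) <w, u> = <w, (A - B) u>. Hence eigenvectors of A and B for eigenvalues
    at distance at least g have an inner product of order |A - B| / g
    ([eigenbasis_overlap]). By Weyl's inequality ([weyl]) the eigenvalues move by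
    at most a multiple of |A - B|, so the gap at x between the eigenvalues
    indexed by I and the others persists, halved, between x and nearby points
    ([near_gap_and_bound]). Therefore a unit vector v of the merged eigenspace at
    one of the points x, x' has small coordinates off I in the eigenbasis at the
    other, and projecting v on the eigenvectors indexed by I and normalizing
    gives a unit vector of the other merged eigenspace close to v
    ([merged_eigenspace_perturb]). The estimate is symmetric in x and x' and
    uniform in v.

    Applied from x to the terms of a sequence, it yields lower hemicontinuity.
    Applied from x' to x, it puts the merged eigenspace at x' inside any given
    uniform neighborhood of the one at x; since the latter is compact
    ([merged_eigenspace_compact]), each of its neighborhoods contains a uniform
    one ([compact_uniform_nbhs]), which is upper hemicontinuity.

    Orthonormal eigenbases over the reals are obtained by deflation, with a
    Householder reflection at each step ([spectral_theorem]). All bounds use the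
    sup norm on matrices, at the price of powers of n that do not affect the
    topology. *)

(** * Euclidean norm and the spectral theorem for real symmetric matrices *)

Lemma symmetricmxP (R : realType) (n : nat) (A : 'M[R]_n) :
  reflect (A^T = A) (A \is symmetricmx).
Proof.
by apply: (iffP (is_hermitianmxP _ _ _)); rewrite expr0 scale1r map_mx_id.
Qed.

(** Over the complex numbers the matrix is Hermitian, so it is unitarily
    diagonalizable with a real diagonal. A real eigenvalue of the complexified
    matrix is a root of the real characteristic polynomial, hence has a real
    eigenvector. *)
Lemma symmetric_eigenvector (R : realType) (n : nat) (A : 'M[R]_n.+1) :
  A^T = A -> exists r, exists2 v : 'cV[R]_n.+1, v != 0 & A *m v = r *: v.
Proof.
move=> Asym; pose C := R[i]; pose Ac := map_mx (real_complex R) A : 'M[C]_n.+1.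
have Aherm : Ac \is hermsymmx.
  apply: realsym_hermsym.
    apply/is_hermitianmxP; rewrite expr0 scale1r map_mx_id //.
    by rewrite /Ac map_trmx Asym.
  by apply/mxOverP => i j; rewrite mxE; apply/complex_realP; exists (A i j).
have /hermitian_normalmx /orthomx_spectralP := Aherm.
have /mxOverP /(_ ord0 ord0) /complex_realP [r dr] :=
  hermitian_spectral_diag_real Aherm.
have Punit := spectral_unit Ac.
move: (spectralmx Ac) (spectral_diag Ac) dr Punit => P D D0 Punit AE.
have : eigenvalue Ac (real_complex R r).
  apply/eigenvalueP; exists (row ord0 P).
    rewrite -row_mul AE mulmxA mulKVmx // row_mul row_diag_mx D0.
    by rewrite -scalemxAl -rowE.
  apply: contraTneq Punit => P0; rewrite unitmxE unitfE negbK.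
  apply/det0P; exists (delta_mx 0 ord0).
    apply/eqP => /matrixP /(_ 0 ord0); rewrite !mxE !eqxx => /eqP.
    by rewrite oner_eq0.
  by rewrite -rowE.
rewrite eigenvalue_map => /eigenvalueP [v vE v0]; exists r, v^T.
  by rewrite trmx_eq0.
by rewrite -[A in LHS]Asym -trmx_mul vE linearZ.
Qed.

Lemma sqr_enorm (R : realType) (n : nat) (v : 'cV[R]_n) :
  enorm v ^+ 2 = (v^T *m v) 0 0.
Proof.
rewrite sqr_sqrtr; last by apply: sumr_ge0 => i _; exact: sqr_ge0.
by rewrite mxE; apply: eq_bigr => i _; rewrite mxE expr2.
Qed.

Lemma enorm_ge0 (R : realType) (n : nat) (v : 'cV[R]_n) : 0 <= enorm v.
Proof. exact: sqrtr_ge0. Qed.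

Lemma enormZ (R : realType) (n : nat) (c : R) (v : 'cV[R]_n) :
  enorm (c *: v) = `|c| * enorm v.
Proof.
rewrite /enorm -sqrtr_sqr -sqrtrM ?sqr_ge0 // mulr_sumr; congr Num.sqrt.
by apply: eq_bigr => i _; rewrite mxE exprMn.
Qed.

Lemma enorm_eq0 (R : realType) (n : nat) (v : 'cV[R]_n) :
  (enorm v == 0) = (v == 0).
Proof.
apply/eqP/eqP => [v0|->]; last first.
  by rewrite /enorm big1 ?sqrtr0 // => i _; rewrite mxE expr0n.
have : \sum_(i < n) v i 0 ^+ 2 = 0.
  have := sqr_enorm v; rewrite v0 expr0n /= mxE => /esym E; rewrite -[RHS]E.
  by apply: eq_bigr => i _; rewrite mxE expr2.
move/psumr_eq0P => /(_ (fun i _ => sqr_ge0 _)) vi0; apply/matrixP => i j.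
by rewrite ord1 mxE; apply/eqP; rewrite -sqrf_eq0 vi0.
Qed.

Lemma unit_sphereP (R : realType) (n : nat) (v : 'cV[R]_n) :
  unit_sphere v <-> v^T *m v = 1%:M.
Proof.
rewrite /unit_sphere /=; split=> [v1|/matrixP/(_ 0 0)].
  by rewrite [LHS]mx11_scalar -sqr_enorm v1 expr1n.
rewrite -sqr_enorm mxE eqxx => /eqP; rewrite sqrf_eq1 => /orP[/eqP //|/eqP vN].
by have := enorm_ge0 v; rewrite vN oppr_ge0 ler10.
Qed.

(** The Householder reflection in the hyperplane orthogonal to w. For w = 0 the
    inverse of 0 is 0 and this is the identity, which is the convenient value:
    reflectionmx (v - u) sends a unit vector u to a unit vector v even when
    u = v. *)
Definition reflectionmx (R : realType) (n : nat) (w : 'cV[R]_n) : 'M[R]_n :=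
  1%:M - (2 / (w^T *m w) 0 0) *: (w *m w^T).

Lemma reflectionmx_sym (R : realType) (n : nat) (w : 'cV[R]_n) :
  (reflectionmx w)^T = reflectionmx w.
Proof. by rewrite /reflectionmx raddfB /= linearZ /= trmx1 trmx_mul trmxK. Qed.

Lemma reflectionmxK (R : realType) (n : nat) (w : 'cV[R]_n) :
  reflectionmx w *m reflectionmx w = 1%:M.
Proof.
rewrite /reflectionmx mulmxBl mul1mx mulmxBr mulmx1 -scalemxAl -scalemxAr.
rewrite mulmxA -[w *m w^T *m w]mulmxA [w^T *m w]mx11_scalar.
set s := (w^T *m w) 0 0; rewrite mxE eqxx mulr1n mul_mx_scalar -scalemxAl !scalerA.
have -> : 2 / s * (2 / s * s) = 2 / s + 2 / s.
  by have [->|s0] := eqVneq s 0; [rewrite invr0 !mulr0 addr0 | field].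
by rewrite scalerDl opprB addrK subrK.
Qed.

(** The hyperplane orthogonal to v - u is the mirror exchanging two vectors of
    equal length. *)
Lemma reflectionmx_swap (R : realType) (n : nat) (u v : 'cV[R]_n) :
  u^T *m u = 1%:M -> v^T *m v = 1%:M -> reflectionmx (v - u) *m u = v.
Proof.
move=> u1 v1; set w := v - u; pose t := (v^T *m u) 0 0.
have tC : u^T *m v = t%:M.
  by rewrite -[LHS]trmxK trmx_mul trmxK [v^T *m u]mx11_scalar tr_scalar_mx.
have wu : w^T *m u = (t - 1)%:M.
  by rewrite /w raddfB /= mulmxBl u1 [v^T *m u]mx11_scalar raddfB.
have ww : w^T *m w = (2 - 2 * t)%:M.
  rewrite {2}/w mulmxBr wu /w raddfB /= mulmxBl v1 tC -!raddfB /=.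
  by congr (_%:M); ring.
rewrite /reflectionmx mulmxBl mul1mx -scalemxAl -mulmxA wu mul_mx_scalar scalerA.
rewrite ww mxE eqxx mulr1n; have [t1|t1] := eqVneq t 1.
  have w0 : w = 0.
    apply/eqP; rewrite -enorm_eq0 -sqrf_eq0 sqr_enorm ww t1 mxE eqxx mulr1n.
    by rewrite mulr1 subrr.
  by rewrite w0 scaler0 subr0; apply/esym/eqP; rewrite -subr_eq0 -/w w0.
have -> : 2 / (2 - 2 * t) * (t - 1) = -1.
  field; rewrite -[X in X - _]mulr1 -mulrBr mulf_neq0 ?pnatr_eq0 //.
  by rewrite subr_eq0 eq_sym.
by rewrite scaleN1r opprK /w addrC subrK.
Qed.

(** Induction by deflation: the Householder reflection H exchanging a unit
    eigenvector with the first basis vector turns A into a symmetric matrix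
    H A H whose first column, hence first row, is zero off the diagonal; the
    remaining block is diagonalized by induction. *)
Lemma spectral_theorem (R : realType) (n : nat) (A : 'M[R]_n) : A^T = A ->
  exists Q : 'M[R]_n, exists2 d : 'rV[R]_n,
    Q^T *m Q = 1%:M & A = Q *m diag_mx d *m Q^T.
Proof.
elim: n A => [|n IH] A Asym.
  by exists 1%:M, 0; [rewrite trmx1 mulmx1 | apply/matrixP => -[]].
have [r [v v0 vE]] := symmetric_eigenvector Asym.
pose w : 'cV[R]_(1 + n) := (enorm v)^-1 *: v.
have w1 : w^T *m w = 1%:M.
  apply/unit_sphereP; rewrite /unit_sphere /= enormZ.
  rewrite ger0_norm ?invr_ge0 ?enorm_ge0 //.
  by rewrite mulVf // enorm_eq0.
have wE : A *m w = r *: w by rewrite /w -scalemxAr vE scalerA mulrC -scalerA.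
pose e : 'cV[R]_(1 + n) := col_mx 1%:M 0.
have e1 : e^T *m e = 1%:M.
  by rewrite tr_col_mx mul_row_col trmx0 mul0mx addr0 trmx1 mul1mx.
pose H := reflectionmx (w - e).
have He : H *m e = w by exact: reflectionmx_swap.
have HT : H^T = H := reflectionmx_sym _.
have HH : H *m H = 1%:M := reflectionmxK _.
pose B : 'M[R]_(1 + n) := H *m A *m H.
have Bsym : B^T = B by rewrite /B !trmx_mul HT Asym mulmxA.
have Be : B *m e = r *: e.
  by rewrite /B -!mulmxA He wE -scalemxAr -He mulmxA HH mul1mx.
have BE : B = block_mx r%:M 0 0 (drsubmx B).
  move: Be; rewrite -{1}[B]submxK mul_block_col !mulmx1 !mulmx0 !addr0.
  rewrite scale_col_mx scaler0 scalemx1 => /eq_col_mx [Bul Bdl].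
  have Bur : ursubmx B = 0.
    by apply: trmx_inj; rewrite trmx_ursub Bsym Bdl trmx0.
  by rewrite -{1}[B]submxK Bul Bdl Bur.
have [|Q [d QQ dE]] := IH (drsubmx B); first by rewrite trmx_drsub Bsym.
pose K : 'M[R]_(1 + n) := block_mx 1%:M 0 0 Q.
have KT : K^T = block_mx 1%:M 0 0 Q^T by rewrite tr_block_mx !trmx0 trmx1.
have KK : K^T *m K = 1%:M.
  rewrite KT mulmx_block !mulmx0 !mul0mx !addr0 add0r mulmx1 QQ.
  by rewrite -scalar_mx_block.
have KB : B = K *m diag_mx (row_mx r%:M d) *m K^T.
  rewrite BE dE KT diag_mx_row !mulmx_block !mulmx0 !mul0mx.
  rewrite !addr0 !add0r mulmx1 mul1mx; congr block_mx; rewrite ?mul0mx //.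
  by apply/matrixP => i j; rewrite !mxE !ord1 eqxx.
exists (H *m K), (row_mx r%:M d).
  by rewrite trmx_mul HT mulmxA -[_ *m H *m H]mulmxA HH mulmx1.
have -> : A = H *m B *m H by rewrite /B !mulmxA HH mul1mx -mulmxA HH mulmx1.
by rewrite trmx_mul HT KB !mulmxA.
Qed.

(** * The sorted list of eigenvalues *)

Lemma char_poly_diagonalized (R : realType) (n : nat) (Q : 'M[R]_n)
    (d : 'rV[R]_n) :
  Q^T *m Q = 1%:M ->
  char_poly (Q *m diag_mx d *m Q^T) = \prod_(i < n) ('X - (d 0 i)%:P).
Proof.
move=> QQ; have QQ' := mulmx1C QQ.
transitivity (char_poly (diag_mx d)); last first.
  rewrite char_poly_trig ?diag_mx_is_trig //.
  by apply: eq_bigr => i _; rewrite mxE eqxx mulr1n.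
rewrite /char_poly; pose P := map_mx (@polyC R) Q.
have PP : P *m P^T = 1%:M by rewrite /P map_trmx -map_mxM QQ' map_mx1.
have -> : char_poly_mx (Q *m diag_mx d *m Q^T) =
    P *m char_poly_mx (diag_mx d) *m P^T.
  rewrite /char_poly_mx mulmxBr mulmxBl mul_mx_scalar -scalemxAl PP scalemx1.
  by rewrite !map_mxM map_trmx.
by rewrite !det_mulmx mulrAC -det_mulmx PP det1 mul1r.
Qed.

Lemma sorted_flatten_nseq (R : realType) (f : R -> nat) (s : seq R) :
  sorted <%R s -> sorted <=%R (flatten [seq nseq (f z) z | z <- s]).
Proof.
rewrite lt_sorted_pairwise le_sorted_pairwise.
elim: s => //= z s IH /andP[zs /IH {}IH]; rewrite pairwise_cat IH andbT.
apply/andP; split; last first.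
  by elim: (f z) => //= k ->; rewrite andbT all_nseq lexx orbT.
apply/allrelP => a b; rewrite mem_nseq => /andP[_ /eqP ->].
move=> /flatten_mapP [y ys]; rewrite mem_nseq => /andP[_ /eqP ->].
by apply: ltW; exact: (allP zs).
Qed.

Lemma eigenvalues_sorted (R : realType) (n : nat) (A : 'M[R]_n) :
  sorted <=%R (eigenvalues A).
Proof. by apply: sorted_flatten_nseq; exact: sorted_roots. Qed.

(** The multiplicity of z in a product of linear factors is the number of
    occurrences of z among the roots, so that the definition of eigenvalues
    merely regroups the list s. *)
Lemma perm_eigenvalues (R : realType) (n : nat) (A : 'M[R]_n) (s : seq R) :
  char_poly A = \prod_(z <- s) ('X - z%:P) -> perm_eq (eigenvalues A) s.
Proof.
move=> As; rewrite /eigenvalues; apply: perm_trans (perm_count_undup s).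
under eq_map do rewrite As mu_prod_XsubC.
rewrite As; apply/perm_flatten/perm_map/uniq_perm;
  rewrite ?undup_uniq ?uniq_roots //.
have s0 : \prod_(z <- s) ('X - z%:P) != 0.
  by apply: monic_neq0; exact: monic_prod_XsubC.
move=> z; have := roots_on_rootsR s0 z.
by rewrite in_itv /= mem_undup => <-; rewrite root_prod_XsubC.
Qed.

Lemma perm_eigenvalues_diag (R : realType) (n : nat) (Q : 'M[R]_n)
    (d : 'rV[R]_n) :
  Q^T *m Q = 1%:M ->
  perm_eq (eigenvalues (Q *m diag_mx d *m Q^T)) [tuple d 0 i | i < n].
Proof.
move=> QQ; apply: perm_eigenvalues.
by rewrite char_poly_diagonalized // big_map big_enum.
Qed.

Lemma size_eigenvalues (R : realType) (n : nat) (A : 'M[R]_n) : A^T = A ->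
  size (eigenvalues A) = n.
Proof.
move=> /spectral_theorem [Q [d QQ ->]].
by rewrite (perm_size (perm_eigenvalues_diag d QQ)) size_tuple.
Qed.

Lemma eigval_le (R : realType) (n : nat) (A : 'M[R]_n) (i j : 'I_n) : A^T = A ->
  (i <= j)%N -> eigval A i <= eigval A j.
Proof.
move=> Asym; apply: (le_sorted_leq_nth 0 (eigenvalues_sorted A));
  by rewrite inE size_eigenvalues.
Qed.

(** * Orthonormal eigenbases and entrywise bounds *)

Definition eigenbasis (R : realType) (n : nat) (A Q : 'M[R]_n) :=
  Q^T *m Q = 1%:M /\ A *m Q = Q *m diag_mx (\row_p eigval A p).

(** The columns of any diagonalizing orthogonal matrix can be permuted so that
    the diagonal becomes the sorted list of eigenvalues: both lists are the
    roots of the characteristic polynomial with multiplicities. *)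
Lemma symmetric_eigenbasis (R : realType) (n : nat) (A : 'M[R]_n) : A^T = A ->
  exists Q, eigenbasis A Q.
Proof.
move=> /spectral_theorem [Q [d QQ AE]].
have := perm_eigenvalues_diag d QQ; rewrite -AE => /tuple_permP [p pE].
have eE (i : 'I_n) : eigval A i = d 0 (p i).
  by rewrite /eigval pE -tnth_nth !tnth_mktuple.
exists (col_perm p Q); split.
  rewrite tr_col_perm col_permE row_permE -mulmxA [_ *m (Q *m _)]mulmxA QQ.
  by rewrite mul1mx -perm_mxM mulgV perm_mx1.
have -> : A *m col_perm p Q = col_perm p (A *m Q) by rewrite !col_permE mulmxA.
rewrite {1}AE -!mulmxA QQ mulmx1 !mul_mx_diag; apply/matrixP => i j.
by rewrite !mxE eE.
Qed.

Lemma eigenbasis_adjoint (R : realType) (n : nat) (A Q : 'M[R]_n) :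
  A^T = A -> eigenbasis A Q ->
  Q^T *m A = diag_mx (\row_p eigval A p) *m Q^T.
Proof.
by move=> Asym [_ AQ]; rewrite -{1}Asym -trmx_mul AQ trmx_mul tr_diag_mx.
Qed.

Lemma sqr_enorm_sum (R : realType) (n : nat) (v : 'cV[R]_n) :
  enorm v ^+ 2 = \sum_i v i 0 ^+ 2.
Proof. by rewrite sqr_sqrtr //; apply: sumr_ge0 => i _; exact: sqr_ge0. Qed.

Lemma coord_le_enorm (R : realType) (n : nat) (v : 'cV[R]_n) i :
  `|v i 0| <= enorm v.
Proof.
rewrite -sqrtr_sqr ler_wsqrtr // (bigD1 i) //= lerDl.
by apply: sumr_ge0 => j _; exact: sqr_ge0.
Qed.

Lemma enorm_orthomx (R : realType) (n : nat) (Q : 'M[R]_n) (v : 'cV[R]_n) :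
  Q^T *m Q = 1%:M -> enorm (Q *m v) = enorm v.
Proof.
move=> QQ; apply: (pexpIrn (n := 2)); rewrite ?nnegrE ?enorm_ge0 //.
by rewrite !sqr_enorm trmx_mul -mulmxA [Q^T *m _]mulmxA QQ mul1mx.
Qed.

Lemma enorm_col (R : realType) (n : nat) (Q : 'M[R]_n) i :
  Q^T *m Q = 1%:M -> enorm (col i Q) = 1.
Proof.
move=> QQ; apply/unit_sphereP.
rewrite tr_col !colE rowE mulmxA -[_ *m Q^T *m Q]mulmxA QQ.
by rewrite mulmx1 mul_delta_mx; apply/matrixP => j k; rewrite !mxE !ord1.
Qed.

Lemma normmx_le (R : realType) (m n : nat) (A : 'M[R]_(m, n)) (c : R) :
  0 <= c -> (forall i j, `|A i j| <= c) -> `|A| <= c.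
Proof.
move=> c0 Ac; rewrite [leLHS]/Num.norm /= mx_normrE.
by apply/bigmax_leP; split => // -[i j] _; exact: Ac.
Qed.

Lemma coord_le_normmx (R : realType) (m n : nat) (A : 'M[R]_(m, n)) i j :
  `|A i j| <= `|A|.
Proof.
rewrite [leRHS]/Num.norm /= mx_normrE.
exact: (le_bigmax_cond _ (fun ij : 'I_m * 'I_n => `|A ij.1 ij.2|)
  (j := (i, j))).
Qed.

(** Crude comparison of the entrywise norm of E with its operator norm: each of
    the n ^ 2 terms of the double sum is bounded separately. Only the linear
    dependence on E matters for continuity. *)
Lemma bilinear_form_le (R : realType) (n : nat) (E : 'M[R]_n)
    (u v : 'cV[R]_n) :
  `|(u^T *m E *m v) 0 0| <= n%:R ^+ 2 * `|E| * (enorm u * enorm v).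
Proof.
rewrite mxE (le_trans (ler_norm_sum _ _ _)) //.
have H i : `|(u^T *m E) 0 i * v i 0| <= n%:R * (`|E| * (enorm u * enorm v)).
  rewrite mxE normrM.
  have : `|\sum_j u^T 0 j * E j i| <= n%:R * (enorm u * `|E|).
    rewrite (le_trans (ler_norm_sum _ _ _)) //.
    rewrite mulr_natl -[X in _ *+ X]card_ord -sumr_const ler_sum // => j _.
    by rewrite normrM mxE ler_pM // ?coord_le_enorm // coord_le_normmx.
  move=> /ler_pM -/(_ `|v i 0| (enorm v)) H.
  apply: le_trans (H _ _ _) _; rewrite ?normr_ge0 ?coord_le_enorm //.
  by rewrite le_eqVlt; apply/orP; left; apply/eqP; ring.
rewrite expr2 -!mulrA mulr_natl -[X in _ *+ X]card_ord -sumr_const.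
by apply: ler_sum.
Qed.

(** * Perturbation of eigenvalues and eigenvectors *)

Lemma rayleighE (R : realType) (n : nat) (A Q : 'M[R]_n) (v : 'cV[R]_n) :
  eigenbasis A Q ->
  (v^T *m A *m v) 0 0 = \sum_k eigval A k * (Q^T *m v) k 0 ^+ 2.
Proof.
move=> [QQ AQ]; have QQ' := mulmx1C QQ.
set a := Q^T *m v.
have -> : v = Q *m a by rewrite /a mulmxA QQ' mul1mx.
rewrite -mulmxA [A *m _]mulmxA AQ trmx_mul -!mulmxA [Q^T *m _]mulmxA QQ mul1mx.
rewrite mxE; apply: eq_bigr => k _; rewrite mul_diag_mx !mxE.
by ring.
Qed.

Lemma rayleigh_ge (R : realType) (n : nat) (A Q : 'M[R]_n) (v : 'cV[R]_n)
    (p : 'I_n) :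
  A^T = A -> eigenbasis A Q ->
  (forall k : 'I_n, (k < p)%N -> (Q^T *m v) k 0 = 0) ->
  eigval A p * enorm v ^+ 2 <= (v^T *m A *m v) 0 0.
Proof.
move=> Asym AQ vQ; rewrite (rayleighE _ AQ).
rewrite -(@enorm_orthomx _ _ Q^T v) ?trmxK; last by rewrite (mulmx1C AQ.1).
rewrite sqr_enorm_sum mulr_sumr ler_sum // => k _.
have [/vQ ->|pk] := ltnP k p; first by rewrite expr0n !mulr0.
by rewrite ler_wpM2r ?sqr_ge0 // eigval_le.
Qed.

Lemma rayleigh_le (R : realType) (n : nat) (A Q : 'M[R]_n) (v : 'cV[R]_n)
    (p : 'I_n) :
  A^T = A -> eigenbasis A Q ->
  (forall k : 'I_n, (p < k)%N -> (Q^T *m v) k 0 = 0) ->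
  (v^T *m A *m v) 0 0 <= eigval A p * enorm v ^+ 2.
Proof.
move=> Asym AQ vQ; rewrite (rayleighE _ AQ).
rewrite -(@enorm_orthomx _ _ Q^T v) ?trmxK; last by rewrite (mulmx1C AQ.1).
rewrite sqr_enorm_sum mulr_sumr ler_sum // => k _.
have [/vQ ->|pk] := ltnP p k; first by rewrite expr0n !mulr0.
by rewrite ler_wpM2r ?sqr_ge0 // eigval_le.
Qed.

(** Weyl's inequality, by dimension count: some nonzero v is orthogonal to the
    first p eigenvectors of A and to the last n - p - 1 of B. On v the Rayleigh
    quotient of A is at least eigval A p, and that of B at most eigval B p. *)
Lemma weyl_le (R : realType) (n : nat) (A B : 'M[R]_n) (p : 'I_n) :
  A^T = A -> B^T = B -> eigval A p <= eigval B p + n%:R ^+ 2 * `|A - B|.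
Proof.
move=> Asym Bsym.
have [QA AQ] := symmetric_eigenbasis Asym.
have [QB BQ] := symmetric_eigenbasis Bsym.
(* Row k of K imposes that v be orthogonal to the k-th eigenvector of A when
   k < p and to that of B when p < k. Row p is zero, so K is singular. *)
pose K := \matrix_(k, j)
  if (k < p)%N then QA^T k j else if (p < k)%N then QB^T k j else 0.
have [v v0 Kv] : exists2 v : 'cV[R]_n, v != 0 & K *m v = 0.
  have /det0P [u u0 uK] : \det K^T == 0.
    rewrite det_tr; apply/det0P; exists (delta_mx 0 p).
      apply/eqP => /matrixP /(_ 0 p); rewrite !mxE !eqxx => /eqP.
      by rewrite oner_eq0.
    by rewrite -rowE; apply/matrixP => i j; rewrite !mxE ltnn.
  exists u^T; rewrite ?trmx_eq0 //.
  by apply: trmx_inj; rewrite trmx_mul trmxK uK trmx0.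
have vA (k : 'I_n) : (k < p)%N -> (QA^T *m v) k 0 = 0.
  move=> kp; have /matrixP /(_ k 0) := Kv; rewrite !mxE => E; rewrite -[RHS]E.
  by apply: eq_bigr => j _; rewrite !mxE kp.
have vB (k : 'I_n) : (p < k)%N -> (QB^T *m v) k 0 = 0.
  move=> kp; have /matrixP /(_ k 0) := Kv; rewrite !mxE => E; rewrite -[RHS]E.
  by apply: eq_bigr => j _; rewrite !mxE kp ltnNge ltnW.
have hA := rayleigh_ge Asym AQ vA.
have hB := rayleigh_le Bsym BQ vB.
have hE := bilinear_form_le (A - B) v v.
have s0 : 0 < enorm v ^+ 2.
  by rewrite exprn_gt0 // lt_neqAle eq_sym enorm_eq0 v0 enorm_ge0.
rewrite -(ler_pM2r s0) mulrDl; apply: (le_trans hA).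
rewrite -[A in leLHS](subrK B) mulmxDr mulmxDl [leLHS]mxE addrC lerD //.
by apply: le_trans (ler_norm _) _; rewrite expr2 // [enorm v ^+ 2]expr2.
Qed.

Lemma weyl (R : realType) (n : nat) (A B : 'M[R]_n) (p : 'I_n) :
  A^T = A -> B^T = B -> `|eigval A p - eigval B p| <= n%:R ^+ 2 * `|A - B|.
Proof.
move=> Asym Bsym; rewrite ler_norml lerBlDl weyl_le // andbT.
by rewrite lerBrDr addrC lerBlDr distrC weyl_le.
Qed.

(** The elementary core of the Davis-Kahan theorem: for A u = a u and B w = b w
    with B symmetric, w^T (A - B) u = (a - b) w^T u. Eigenvectors of nearby
    matrices for well separated eigenvalues are thus almost orthogonal. *)
Lemma eigenbasis_overlap (R : realType) (n : nat) (A B QA QB : 'M[R]_n)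
    (k i : 'I_n) :
  B^T = B -> eigenbasis A QA -> eigenbasis B QB ->
  `|eigval A i - eigval B k| * `|(QB^T *m QA) k i| <= n%:R ^+ 2 * `|A - B|.
Proof.
move=> Bsym AQ BQ.
have : (QB^T *m (A - B) *m QA) k i =
    (eigval A i - eigval B k) * (QB^T *m QA) k i.
  rewrite mulmxBr mulmxBl (eigenbasis_adjoint Bsym BQ) -mulmxA AQ.2 mulmxA.
  rewrite mul_mx_diag -mulmxA mul_diag_mx !mxE; ring.
rewrite -normrM => <-.
have -> : (QB^T *m (A - B) *m QA) k i =
    ((col k QB)^T *m (A - B) *m col i QA) 0 0.
  by rewrite tr_col -row_mul colE mulmxA -row_mul -colE !mxE.
apply: le_trans (bilinear_form_le _ _ _) _.
by rewrite !enorm_col ?mulr1 //; [case: AQ|case: BQ].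
Qed.

(** * Merged eigenspaces *)

(** Eigenvectors of a symmetric matrix for different eigenvalues are orthogonal.
    The index k is excluded according to its eigenvalue and not to membership in
    I, which makes this valid at points where an eigenvalue indexed by I
    coincides with one that is not. *)
Lemma merged_eigenspace_coord (R : realType) (N n : nat)
    (L : 'cV[R]_N -> 'M[R]_n) (I : {set 'I_n}) (x : 'cV[R]_N) (Q : 'M[R]_n)
    (v : 'cV[R]_n) (k : 'I_n) :
  (L x)^T = L x -> eigenbasis (L x) Q ->
  (forall i, i \in I -> eigval (L x) i != eigval (L x) k) ->
  merged_eigenspace L I x v -> (Q^T *m v) k 0 = 0.
Proof.
move=> Lsym LQ Ik [[X XI vX] _].
rewrite (coord_span (X := in_tuple X) vX) mulmx_sumr summxE big1 // => j _.
rewrite -scalemxAr mxE.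
have [p /= pI [_ uE]] :
    (\bigcup_(p in [set` I]) unit_eigenvectors (L x) p) X`_j.
  by apply: XI; rewrite mem_nth.
have /matrixP /(_ k 0) :
    Q^T *m L x *m X`_j = eigval (L x) p *: (Q^T *m X`_j).
  by rewrite -mulmxA uE -scalemxAr.
rewrite (eigenbasis_adjoint Lsym LQ) -mulmxA mul_diag_mx [in LHS]mxE [in RHS]mxE.
rewrite [X in X * _]mxE => /eqP; rewrite -subr_eq0 -mulrBl mulf_eq0 subr_eq0.
by rewrite eq_sym (negPf (Ik p pI)) => /eqP ->; rewrite mulr0.
Qed.

Lemma merged_eigenspace_unit (R : realType) (N n : nat) (L : 'cV[R]_N -> 'M[R]_n)
    (I : {set 'I_n}) (x : 'cV[R]_N) (v : 'cV[R]_n) :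
  merged_eigenspace L I x v -> enorm v = 1.
Proof. by case. Qed.

Lemma merged_eigenspace_of_coord (R : realType) (N n : nat)
    (L : 'cV[R]_N -> 'M[R]_n) (I : {set 'I_n}) (x : 'cV[R]_N) (Q : 'M[R]_n)
    (v : 'cV[R]_n) :
  eigenbasis (L x) Q -> enorm v = 1 ->
  (forall k, k \notin I -> (Q^T *m v) k 0 = 0) ->
  merged_eigenspace L I x v.
Proof.
move=> [QQ LQ] v1 vI; split=> //.
exists [seq col i Q | i <- enum I].
  move=> _ /mapP [i iI ->]; exists i => /=; first by rewrite mem_enum in iI.
  split; first exact: enorm_col.
  rewrite colE mulmxA LQ mul_mx_diag -!colE; apply/matrixP => a b.
  by rewrite !mxE mulrC.
have -> : v = \sum_i (Q^T *m v) i 0 *: col i Q.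
  rewrite -[LHS]mul1mx -(mulmx1C QQ) -mulmxA; apply/matrixP => a b.
  rewrite mxE summxE; apply: eq_bigr => i _; rewrite !mxE ord1.
  by rewrite mulrC.
apply: memv_suml => i _; have [iI|/vI ->] := boolP (i \in I).
  by apply/memvZ/memv_span/map_f; rewrite mem_enum.
by rewrite scale0r mem0v.
Qed.

(** The span of the empty family contains no unit vector. *)
Lemma merged_eigenspace_index (R : realType) (N n : nat) (L : 'cV[R]_N -> 'M[R]_n)
    (I : {set 'I_n}) (x : 'cV[R]_N) (v : 'cV[R]_n) :
  (L x)^T = L x -> merged_eigenspace L I x v -> exists i, i \in I.
Proof.
move=> Lsym vI; have [I0|[i iI]] := set_0Vmem I; last by exists i.
have [Q LQ] := symmetric_eigenbasis Lsym; have QQ := LQ.1.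
have v0 : Q^T *m v = 0.
  apply/matrixP => k j; rewrite ord1 [RHS]mxE.
  apply: (merged_eigenspace_coord Lsym LQ _ vI) => i.
  by rewrite I0 inE.
have := merged_eigenspace_unit vI.
rewrite -(@enorm_orthomx _ _ Q^T v) ?trmxK ?(mulmx1C QQ) // v0 => /eqP.
have /eqP -> : enorm (0 : 'cV[R]_n) == 0 by rewrite enorm_eq0.
by rewrite eq_sym oner_eq0.
Qed.

(** Project v orthogonally on the span of the columns of Q indexed by I and
    normalize. If the coordinates of v off I are at most d <= 1, the projection
    moves v by at most n d in sup norm and has squared length at least
    1 - n d ^ 2 >= 1 - n d, so normalizing moves it by at most another n d. The
    vector w is chosen before d because the same w has to serve for every d;
    when the projection vanishes, which a small d rules out, any column indexed
    by I will do. *)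
Lemma normalized_projection (R : realType) (n : nat) (Q : 'M[R]_n)
    (I : {set 'I_n}) (i0 : 'I_n) (v : 'cV[R]_n) :
  Q^T *m Q = 1%:M -> i0 \in I -> enorm v = 1 ->
  exists w : 'cV[R]_n,
    [/\ enorm w = 1, forall k, k \notin I -> (Q^T *m w) k 0 = 0 &
      forall d : R, 0 <= d -> (forall k, k \notin I -> `|(Q^T *m v) k 0| <= d) ->
        2 * n%:R * d < 1 -> `|v - w| <= 2 * n%:R * d].
Proof.
move=> QQ i0I v1; have QQ' := mulmx1C QQ.
pose y := Q^T *m v; pose z : 'cV[R]_n := \col_k (if k \in I then y k 0 else 0).
pose p := Q *m z; pose c := enorm p.
have y1 : \sum_k y k 0 ^+ 2 = 1.
  by rewrite -sqr_enorm_sum /y enorm_orthomx ?trmxK // v1 expr1n.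
have c2 : c ^+ 2 = \sum_(k in I) y k 0 ^+ 2.
  rewrite /c /p enorm_orthomx // sqr_enorm_sum [RHS]big_mkcond.
  by apply: eq_bigr => k _; rewrite mxE; case: ifP => // _; rewrite expr0n.
have c1 : 1 - c ^+ 2 = \sum_(k | k \notin I) y k 0 ^+ 2.
  by rewrite -y1 (bigID (mem I)) /= c2 addrC addrK.
have c0 : 0 <= c := enorm_ge0 _.
have n1 : 1 <= n%:R :> R by rewrite ler1n (leq_ltn_trans _ (ltn_ord i0)).
have small (d : R) : 0 <= d -> (forall k, k \notin I -> `|y k 0| <= d) ->
    2 * n%:R * d < 1 -> 1 - c ^+ 2 <= n%:R * d.
  move=> d0 yd nd; have d1 : d <= 1.
    have dn : d <= n%:R * d by rewrite ler_peMl.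
    by move: nd; rewrite -mulrA; set t := n%:R * d in dn *; lra.
  rewrite c1 big_mkcond mulr_natl -[X in _ *+ X]card_ord -sumr_const.
  apply: ler_sum => k _; case: ifPn => // kI.
  rewrite -real_normK ?num_real // expr2.
  apply: le_trans (_ : d * 1 <= _); last by rewrite mulr1.
  by rewrite ler_pM // ?yd //; apply: le_trans (yd _ kI) d1.
exists (if c == 0 then col i0 Q else c^-1 *: p); split.
- case: ifPn => [_|cN0]; first exact: enorm_col.
  by rewrite enormZ ger0_norm ?invr_ge0 // mulVf.
- move=> k kI; case: ifPn => [_|cN0].
    rewrite colE mulmxA QQ mul1mx mxE andbT; case: eqP => // ki.
    by rewrite ki i0I in kI.
  by rewrite -scalemxAr mulmxA QQ mul1mx !mxE (negPf kI) mulr0.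
move=> d d0 yd nd; have cs := small d d0 yd nd.
have cN0 : c != 0.
  apply: contraTneq nd => cE.
  move: cs; rewrite cE expr0n subr0 -mulrA -leNgt.
  by set t := n%:R * d; lra.
rewrite (negPf cN0); set w := c^-1 *: p.
have w1 : enorm w = 1 by rewrite enormZ ger0_norm ?invr_ge0 // mulVf.
have cle1 : c <= 1.
  rewrite -(@expr_le1 _ 2) // -subr_ge0 c1.
  by apply: sumr_ge0 => i _; exact: sqr_ge0.
have pw : p = c *: w by rewrite scalerA mulfV // scale1r.
have vp i : `|(v - p) i 0| <= n%:R * d.
  have -> : (v - p) i 0 = \sum_k Q i k * (y k 0 - z k 0).
    rewrite -[v]mul1mx -QQ' -mulmxA -mulmxBr mxE; apply: eq_bigr => k _.
    by rewrite !mxE.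
  rewrite (le_trans (ler_norm_sum _ _ _)) // mulr_natl.
  rewrite -[X in _ *+ X]card_ord -sumr_const.
  apply: ler_sum => k _; rewrite normrM [z k 0]mxE -[d]mul1r ler_pM //.
    by have := coord_le_enorm (col k Q) i; rewrite enorm_col // mxE.
  by case: ifPn => kI; rewrite ?subrr ?normr0 ?subr0 ?yd.
apply: normmx_le => [|i j]; first by rewrite !mulr_ge0.
rewrite ord1 -[v](subrK p) -addrA mxE.
apply: le_trans (ler_normD _ _) _.
have -> : 2 * n%:R * d = n%:R * d + n%:R * d by ring.
apply: lerD => //; rewrite pw -{2}[w]scale1r -scalerBl mxE normrM.
rewrite -[leRHS]mulr1 ler_pM //; last by rewrite -w1 coord_le_enorm.
rewrite distrC ger0_norm ?subr_ge0 //; apply: le_trans cs.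
by rewrite lerB // expr2 ler_piMl.
Qed.

(** In an eigenbasis at x', the coordinates off I of a vector v of the merged
    eigenspace at x are sums of at most n overlaps, each bounded by
    n ^ 2 |L x - L x'| / g. The normalized projection of v is then close to v.
    The gap g is quantified after w, so that a sequence of points x' yields a
    vector at every term, including those far from the limit. *)
Lemma merged_eigenspace_perturb (R : realType) (N n : nat)
    (L : 'cV[R]_N -> 'M[R]_n) (I : {set 'I_n}) (x x' : 'cV[R]_N) (v : 'cV[R]_n) :
  (forall x, (L x)^T = L x) -> merged_eigenspace L I x v ->
  exists2 w, merged_eigenspace L I x' w &
    forall g, 0 < g ->
      (forall i k, i \in I -> k \notin I ->
        g <= `|eigval (L x) i - eigval (L x') k|) ->
      2 * n%:R ^+ 4 * `|L x - L x'| / g < 1 ->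
      `|v - w| <= 2 * n%:R ^+ 4 * `|L x - L x'| / g.
Proof.
move=> Lsym vI.
have [i0 i0I] := merged_eigenspace_index (Lsym x) vI.
have v1 := merged_eigenspace_unit vI.
have [P LP] := symmetric_eigenbasis (Lsym x); have PP := LP.1.
have [Q LQ] := symmetric_eigenbasis (Lsym x'); have QQ := LQ.1.
have [w [w1 wI wd]] := normalized_projection QQ i0I v1.
exists w; first exact: (merged_eigenspace_of_coord LQ).
move=> g g0 gap; set e := `|L x - L x'|.
have -> : 2 * n%:R ^+ 4 * e / g = 2 * n%:R * (n%:R * (n%:R ^+ 2 * e / g)).
  by ring.
apply: wd => [|k kI].
  by rewrite !mulr_ge0 ?invr_ge0 ?(ltW g0) // normr_ge0.
have -> : Q^T *m v = (Q^T *m P) *m (P^T *m v).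
  by rewrite -mulmxA [P *m _]mulmxA (mulmx1C PP) mul1mx.
rewrite mxE (le_trans (ler_norm_sum _ _ _)) // mulr_natl.
rewrite -[X in _ *+ X]card_ord -sumr_const.
apply: ler_sum => i _; rewrite normrM.
have b0 : 0 <= n%:R ^+ 2 * e / g.
  by rewrite !mulr_ge0 ?invr_ge0 ?(ltW g0) // normr_ge0.
have [/existsP [j /andP [jI /eqP ji]]|iN] :=
    boolP [exists j, (j \in I) && (eigval (L x) j == eigval (L x) i)].
  rewrite -[leRHS]mulr1 ler_pM //.
    rewrite ler_pdivlMr // mulrC.
    apply: le_trans (eigenbasis_overlap k i (Lsym x') LP LQ).
    by rewrite ler_wpM2r // -ji gap.
  rewrite -v1 -(@enorm_orthomx _ _ P^T v) ?trmxK ?(mulmx1C PP) //.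
  exact: coord_le_enorm.
rewrite (merged_eigenspace_coord (Lsym x) LP _ vI) ?normr0 ?mulr0 //.
move=> j jI; apply: contraNneq iN => ji; apply/existsP; exists j.
by rewrite jI ji eqxx.
Qed.

(** * Compactness and neighborhoods *)

Lemma trmx_continuous (R : realType) (m n : nat) :
  continuous (@trmx R m n).
Proof.
move=> A; apply/(@cvgrPdist_lt _ _ _ (nbhs A) (nbhs_filter A)) => e e0.
near=> B.
rewrite -raddfB; apply: le_lt_trans (_ : `|A - B| < e).
  by apply: normmx_le => // i j; rewrite mxE coord_le_normmx.
by near: B; apply: cvgr_dist_lt.
Unshelve. all: by end_near. Qed.

Lemma continuous_sum (R : realType) (T : topologicalType) (J : finType)
    (F : J -> T -> R) :
  (forall j, continuous (F j)) -> continuous (fun t => \sum_j F j t).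
Proof.
move=> Fc; apply: continuous_big => [|j _]; last exact: Fc.
exact: add_continuous.
Qed.

(** Under the gap condition the merged eigenspace is cut out of the unit sphere by
    the vanishing of the coordinates off I. Transposition reduces the claim to
    the Heine-Borel theorem for row vectors. *)
Lemma merged_eigenspace_compact (R : realType) (N n : nat)
    (L : 'cV[R]_N -> 'M[R]_n) (I : {set 'I_n}) (x : 'cV[R]_N) :
  (L x)^T = L x ->
  (forall i j, i \in I -> j \notin I -> eigval (L x) i <> eigval (L x) j) ->
  compact (merged_eigenspace L I x).
Proof.
move=> Lsym gap; have [Q LQ] := symmetric_eigenbasis Lsym.
pose K : set 'rV[R]_n := [set r | \sum_i r 0 i ^+ 2 = 1] `&`
  \bigcap_(k in [set k | k \notin I]) [set r | \sum_i Q i k * r 0 i = 0].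
have -> : merged_eigenspace L I x = trmx @` K.
  apply/seteqP; split => [v vI|_ [r [r1 rI] <-]].
    exists v^T; last by rewrite trmxK.
    split=> [/=|k /= kI].
      transitivity (\sum_i v i 0 ^+ 2).
        by apply: eq_bigr => i _; rewrite mxE.
      by rewrite -sqr_enorm_sum (merged_eigenspace_unit vI) expr1n.
    transitivity ((Q^T *m v) k 0).
      by rewrite mxE; apply: eq_bigr => i _; rewrite !mxE.
    apply: (merged_eigenspace_coord Lsym LQ _ vI) => i iI.
    by apply/eqP/gap.
  apply: (merged_eigenspace_of_coord LQ).
    have : \sum_i r^T i 0 ^+ 2 = 1.
      by rewrite -[RHS]r1; apply: eq_bigr => i _; rewrite mxE.
    by rewrite /enorm => ->; rewrite sqrtr1.
  move=> k kI; rewrite -[RHS](rI k kI) mxE.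
  by apply: eq_bigr => i _; rewrite !mxE.
apply: continuous_compact; first exact/continuous_subspaceT/trmx_continuous.
apply: bounded_closed_compact.
  exists 1; split => // M M1 r [/= r1 _]; apply: le_trans (ltW M1).
  apply: normmx_le => // i j; rewrite ord1.
  rewrite -(@expr_le1 _ 2) // real_normK ?num_real // -r1 (bigD1 j) //= lerDl.
  by apply: sumr_ge0 => k _; exact: sqr_ge0.
have cc i : continuous (fun r : 'rV[R]_n => r 0 i) by exact: coord_continuous.
apply: closedI.
  apply: (@preimage_closed _ _ (fun r : 'rV[R]_n => \sum_i r 0 i ^+ 2) [set 1]).
    move=> r _; apply: continuous_sum => i {}r.
    apply: (@continuous_comp _ _ _ (fun r : 'rV[R]_n => r 0 i) (fun t => t ^+ 2)).
      exact: cc.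
    exact: exprn_continuous.
  exact: closed_eq.
apply: closed_bigI => k _.
apply: (@preimage_closed _ _ (fun r : 'rV[R]_n => \sum_i Q i k * r 0 i) [set 0]).
  move=> r _; apply: continuous_sum => i {}r.
  by apply: continuousM; [exact: cst_continuous | exact: cc].
exact: closed_eq.
Qed.

(** If A contains the ball of radius d around w, then radius d / 2 suits all
    points close to w; compactness of K leaves finitely many radii to compare,
    which here is the near-covering property for the filter of e at 0+. *)
Lemma compact_uniform_nbhs (R : realType) (V : normedModType R) (K A : set V) :
  compact K -> set_nbhs K A ->
  exists2 e : R, 0 < e & forall w v, K w -> `|w - v| < e -> A v.
Proof.
move=> /compact_near_coveringP Kc KA.
have : \forall e \near 0^'+, K `<=` [set w | forall v, `|w - v| < e -> A v].
  apply: (Kc _ _ (fun e w => forall v, `|w - v| < e -> A v)) => w Kw.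
  have /nbhs_normP [d /= d0 dA] := KA _ Kw.
  near=> w' e => v vw'; apply: dA => /=.
  have ww' : `|w - w'| < d / 2.
    by near: w'; apply: cvgr_dist_lt => //; rewrite divr_gt0.
  have e2 : e < d / 2 by near: e; apply: nbhs_right_lt; rewrite divr_gt0.
  apply: le_lt_trans (ler_distD w' _ _) _.
  by rewrite [d]splitr ltrD // (lt_trans vw').
move=> Ke.
have [e [e0 eA]] : exists e : R,
    0 < e /\ (K `<=` [set w | forall v, `|w - v| < e -> A v]).
  near (0 : R)^'+ => e; exists e; split=> //.
  near: e; exact: Ke.
by exists e => // w v Kw; exact: eA.
Unshelve. all: by end_near. Qed.

Lemma eigval_gap (R : realType) (n : nat) (A : 'M[R]_n) (I : {set 'I_n}) :
  (forall i j, i \in I -> j \notin I -> eigval A i <> eigval A j) ->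
  exists2 g : R, 0 < g & forall i j, i \in I -> j \notin I ->
    g <= `|eigval A i - eigval A j|.
Proof.
move=> gap.
exists (\big[Num.min/1]_(ij : 'I_n * 'I_n | (ij.1 \in I) && (ij.2 \notin I))
   `|eigval A ij.1 - eigval A ij.2|).
  apply/bigmin_gtP; split => // -[i j] /andP[/= iI jI].
  by rewrite normr_gt0 subr_eq0; apply/eqP/gap.
move=> i j iI jI.
apply: (bigmin_le_cond _ (fun ij => `|eigval A ij.1 - eigval A ij.2|)
  (j := (i, j))).
by rewrite /= iI.
Qed.

(** By Weyl's inequality half of the gap at x survives between eigenvalues at x
    and eigenvalues at a nearby x', while continuity of L makes the bound of
    merged_eigenspace_perturb as small as desired. The two inequalities on
    eigenvalues serve to move vectors from x to x' and from x' to x. *)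
Lemma near_gap_and_bound (R : realType) (N n : nat)
    (L : 'cV[R]_N -> 'M[R]_n) (I : {set 'I_n}) (x : 'cV[R]_N) (e : R) :
  (forall x, (L x)^T = L x) -> {for x, continuous L} ->
  (forall i j, i \in I -> j \notin I -> eigval (L x) i <> eigval (L x) j) ->
  0 < e ->
  exists g : R, 0 < g /\ \forall x' \near x,
    [/\ 2 * n%:R ^+ 4 * `|L x - L x'| / g < 1,
        2 * n%:R ^+ 4 * `|L x - L x'| / g < e &
        forall i k, i \in I -> k \notin I ->
          g <= `|eigval (L x) i - eigval (L x') k| /\
          g <= `|eigval (L x') i - eigval (L x) k| ].
Proof.
move=> Lsym Lc gap e0; have [g g0 gI] := eigval_gap gap.
exists (g / 2); split; first by rewrite divr_gt0.
have small (c r : R) : 0 <= c -> 0 < r ->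
    \forall x' \near x, c * `|L x - L x'| < r.
  move=> c0 r0; have c1 : 0 < c + 1 by rewrite ltr_wpDl.
  near=> x'.
  have : `|L x - L x'| < r / (c + 1).
    near: x'; apply: (@cvgr_dist_lt _ _ _ (nbhs x) (nbhs_filter x) L _ Lc).
    by rewrite divr_gt0.
  rewrite ltr_pdivlMr // mulrC; apply: le_lt_trans.
  by rewrite ler_wpM2r // lerDl.
have nc : (0 : R) <= 2 * n%:R ^+ 4 / (g / 2).
  by rewrite mulr_ge0 ?invr_ge0 ?mulr_ge0 ?exprn_ge0 ?invr_ge0 // ltW.
near=> x'.
split; first by rewrite mulrAC; near: x'; apply: small.
  by rewrite mulrAC; near: x'; apply: small.
have hw : n%:R ^+ 2 * `|L x - L x'| < g / 2.
  by near: x'; apply: small; rewrite ?exprn_ge0 ?divr_gt0.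
have H (i : 'I_n) : `|eigval (L x) i - eigval (L x') i| < g / 2.
  by apply: le_lt_trans hw; exact: weyl.
move=> i k iI kI; split.
  have := ler_distD (eigval (L x') k) (eigval (L x) i) (eigval (L x) k).
  have := gI _ _ iI kI; have := H k; rewrite [`|eigval (L x') k - _|]distrC; lra.
have := ler_distD (eigval (L x') i) (eigval (L x) i) (eigval (L x) k).
have := gI _ _ iI kI; have := H i; lra.
Unshelve. all: by end_near. Qed.

Lemma nbhs_enorm_ball (R : realType) (n : nat) (x : 'cV[R]_n) (P : set 'cV[R]_n) :
  nbhs x P -> exists2 d : R, 0 < d & forall y, enorm (x - y) < d -> P y.
Proof.
move=> /nbhs_normP [d /= d0 dP]; exists d => // y xy; apply: dP => /=.
apply: le_lt_trans xy; apply: normmx_le; first exact: enorm_ge0.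
by move=> i j; rewrite ord1 coord_le_enorm.
Qed.

(** * Continuity *)

Theorem theorem6p1 (R : realType) (N n : nat) (L : 'cV[R]_N -> 'M[R]_n)
    (L_sym : forall x, L x \is symmetricmx) (L_cont : continuous L)
    (I : {set 'I_n}) (x : 'cV[R]_N)
    (gap : forall i j : 'I_n, i \in I -> j \notin I ->
       eigval (L x) i <> eigval (L x) j) :
  hemicontinuous_at (merged_eigenspace L I) x.
Proof.
have Lsym y : (L y)^T = L y by apply/symmetricmxP.
split.
- move=> V UV.
  have Uc := merged_eigenspace_compact (Lsym x) gap.
  have [e e0 eV] := compact_uniform_nbhs Uc UV.
  have [g [g0 near_x]] := near_gap_and_bound Lsym (L_cont x) gap e0.
  have [d d0 dx] := nbhs_enorm_ball near_x.
  exists d => // x' /dx [lt1 lte gxx'] v vI.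
  have [w wI vw] := merged_eigenspace_perturb x Lsym vI.
  apply: (eV w) => //; rewrite distrC.
  have := vw g g0; rewrite [`|L x' - L x|]distrC => /(_ _ lt1) vwg.
  by apply: le_lt_trans lte; apply: vwg => i k iI kI; exact: (gxx' i k iI kI).2.
- move=> u uI xs xsx.
  have /choice [us usP] : forall k, exists w, merged_eigenspace L I (xs k) w /\
      forall g, 0 < g ->
      (forall i k', i \in I -> k' \notin I ->
        g <= `|eigval (L x) i - eigval (L (xs k)) k'|) ->
      2 * n%:R ^+ 4 * `|L x - L (xs k)| / g < 1 ->
      `|u - w| <= 2 * n%:R ^+ 4 * `|L x - L (xs k)| / g.
    move=> k; have [w wI uw] := merged_eigenspace_perturb (xs k) Lsym uI.
    by exists w.
  exists us; last by move=> k; exact: (usP k).1.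
  apply/cvgrPdist_lt => e e0.
  have [g [g0 near_x]] := near_gap_and_bound Lsym (L_cont x) gap e0.
  apply: (@filterS _ \oo _ _ _ _ (xsx _ near_x)) => k /= [lt1 lte gxx'].
  apply: le_lt_trans lte; apply: (usP k).2 => // i k' iI kI.
  exact: (gxx' i k' iI kI).1.
Qed.
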